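(* Let $n\ge1$ be an integer and $s\in\mathbb{R}$. For any non-empty Borel (or analytic) set $A\subset\mathbb{R}^n$ with $\dim_P A>s$ there exists a compact set $B\subset\mathbb{R}^n$ such that $B$ has zero $(n-s)$-dimensional Hausdorff measure and $A+B$ has non-empty interior.
   Context: $\dim_P$ denotes packing dimension. $A+B=\{a+b:a\in A,\ b\in B\}$ is the Minkowski sum. *)

(* Defs.v *)
From HB Require Import structures.
From mathcomp Require Import all_boot all_order all_algebra.
From mathcomp Require Import all_classical all_reals all_analysis.
Import Order.TTheory GRing.Theory Num.Theory.
Import numFieldNormedType.Exports.

Set Implicit Arguments.
Unset Strict Implicit.
Unset Printing Implicit Defensive.

Local Open Scope classical_set_scope.
Local Open Scope ring_scope.

(* The library topology on 'rV[R]_n is the product topology, hence the usual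
   one, but the library norm is the sup norm; diameters and balls below are
   Euclidean. *)
Definition euclidean_dist (R : realType) (n : nat) (x y : 'rV[R]_n) : R :=
  Num.sqrt (\sum_(i < n) (x 0 i - y 0 i) ^+ 2).

Definition euclidean_cball (R : realType) (n : nat) (c : 'rV[R]_n) (r : R) :
  set 'rV[R]_n := [set x | euclidean_dist c x <= r].

(* diam set0 = -oo; every use below treats set0 separately or tolerates this. *)
Definition diam (R : realType) (n : nat) (U : set 'rV[R]_n) : \bar R :=
  ereal_sup [set (euclidean_dist x y)%:E | x in U & y in U].

(* (diam U)^d for d >= 0, with the conventions 0^0 = 1 for nonempty U, and
   contribution 0 for U empty (including when d = 0). *)
Definition diam_pow (R : realType) (n : nat) (d : R) (U : set 'rV[R]_n) :
  \bar R := if U == set0 then 0%E else (diam U `^ d)%E.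

Definition hausdorff_premeasure (R : realType) (n : nat) (d delta : R)
    (A : set 'rV[R]_n) : \bar R :=
  ereal_inf [set (\sum_(k <oo) diam_pow d (U k))%E | U in
    [set U : nat -> set 'rV[R]_n |
      A `<=` \bigcup_k U k /\ forall k, (diam (U k) <= delta%:E)%E]].

Definition hausdorff_measure (R : realType) (n : nat) (d : R)
    (A : set 'rV[R]_n) : \bar R :=
  ereal_sup [set hausdorff_premeasure d delta A | delta in [set x : R | 0 < x]].

(* A delta-packing of A: an at most countable family, indexed by D, of pairwise
   disjoint closed balls of radius at most delta centred in A. *)
Definition is_packing (R : realType) (n : nat) (delta : R) (A : set 'rV[R]_n)
    (D : set nat) (c : nat -> 'rV[R]_n) (r : nat -> R) : Prop :=
  (forall i, D i -> A (c i) /\ 0 < r i <= delta) /\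
  trivIset D (fun i => euclidean_cball (c i) (r i)).

(* 2 r is the diameter of a closed ball of radius r when n >= 1. *)
Definition packing_premeasure_at (R : realType) (n : nat) (t delta : R)
    (A : set 'rV[R]_n) : \bar R :=
  ereal_sup [set x | exists D c r, is_packing delta A D c r /\
    x = (\esum_(i in D) ((2 * r i) `^ t)%:E)%E].

Definition packing_premeasure (R : realType) (n : nat) (t : R)
    (A : set 'rV[R]_n) : \bar R :=
  ereal_inf [set packing_premeasure_at t delta A |
    delta in [set x : R | 0 < x]].

Definition packing_measure (R : realType) (n : nat) (t : R)
    (A : set 'rV[R]_n) : \bar R :=
  ereal_inf [set (\sum_(k <oo) packing_premeasure t (E k))%E | E in
    [set E : nat -> set 'rV[R]_n | A `<=` \bigcup_k E k]].

Definition packing_dim (R : realType) (n : nat) (A : set 'rV[R]_n) : \bar R :=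
  ereal_inf [set t%:E | t in [set t : R | 0 <= t /\ packing_measure t A = 0%E]].

Definition borel (T : topologicalType) (A : set T) : Prop :=
  <<s [set U : set T | open U] >> A.

Definition baire_space := prod_topology (fun _ : nat => nat).

Definition analytic (T : topologicalType) (A : set T) : Prop :=
  A = set0 \/
  exists f : baire_space -> T, continuous f /\ range f = A.

Definition minkowski_sum (R : realType) (n : nat) (A B : set 'rV[R]_n) :
  set 'rV[R]_n := [set a + b | a in A & b in B].

(* Main.v *)
Require Import Defs.
From mathcomp Require Import all_boot all_order all_algebra.
From mathcomp Require Import all_classical all_reals all_analysis.
From mathcomp Require finmap.
From mathcomp Require Import ring lra zify.
Import Order.TTheory GRing.Theory Num.Theory.
Import numFieldNormedType.Exports.
Set Implicit Arguments.
Unset Strict Implicit.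
Unset Printing Implicit Defensive.
Local Open Scope classical_set_scope.
Local Open Scope ring_scope.

(** Fix s < t < dim_P A (or t = 0 when s < 0) and measure sets by how many dyadic
cubes of side 2^-m they meet.  A set is [thin] when, at all small scales, it
meets fewer than 2^(tm) cubes.  Countable unions of thin sets ([sigma_thin])
have zero t'-dimensional packing measure for every t' > t, because the balls of
comparable radii in a packing occupy distinct cubes; hence A is not
[sigma_thin] ([packing_dim_not_sigma_thin]).

One scale.  Suppose a bounded set E meets N >= 2^(tm) cubes of side 2^-m at
arbitrarily large m.  In the grid Z^n, each cube of [0,1)^n is reached from
some cube of E by exactly N of the roughly 2^(nm) relevant translations.  A
greedy choice therefore covers [0,1)^n by E + Y up to an error 2^-m with
|Y| = O(m 2^((n-t)m)) translations ([greedy_cover], [cube_translates]).  Since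
t > s, |Y| (2^-m)^(n-s) is as small as desired ([thick_cube_cover]).

All scales.  Borel and analytic sets are projections of closed subsets C of
N^N x R^n ([souslin_borel_or_analytic]).  Discarding countably many small pieces
leaves [regular] points of C, all of whose neighbourhoods have a projection that
is not [sigma_thin]; around any of them the one-scale step applies and yields
finitely many new regular points in a prescribed neighbourhood
([regular_step]).  Iterating gives a finitely branching tree of regular points
in which every node covers the same cube [0,1)^n, with its own scale and its own
finite set of translations.  Let B be the intersection over all levels of the
finite unions of small balls around the translations of that level; the
contribution of a node to the (n-s)-dimensional sum of a level is chosen after
the number of nodes of the level is known, so B is compact of measure zero.
Given z in the cube, follow a branch along which z is covered.  Its points
converge in N^N x R^n, so their limit projects to some a in A, and z - a belongs
to B because it is close to a translation at each level. *)

(** * Borel and analytic sets as projections of closed sets *)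

(** Closedness in N^N x R^n, spelled out with basic neighbourhoods (common
prefixes, norm distance) so that coding arguments on sequences become arithmetic
on prefix lengths. *)
Definition closed_relation (R : realType) (n : nat)
    (C : (nat -> nat) -> 'rV[R]_n -> Prop) : Prop :=
  forall z x,
    (forall k, exists z' x',
      [/\ C z' x', forall i, (i < k)%N -> z' i = z i & `|x - x'| <= 2^-1 ^+ k]) ->
    C z x.

(** Asking for a projection rather than a continuous image of N^N makes closed sets
trivial and lets countable intersections be taken pointwise in x. *)
Definition souslin (R : realType) (n : nat) (A : set 'rV[R]_n) : Prop :=
  exists2 C, closed_relation C & A = [set x | exists z, C z x].

Lemma half_expn_lt (R : realType) (e : R) : 0 < e -> exists k, 2^-1 ^+ k < e.
Proof.
move=> e0.
have h : 2^-1 ^+ x @[x --> \oo] --> (0 : R).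
  by apply: cvg_expr; rewrite ger0_norm; lra.
have /cvgr0Pnorm_lt/(_ _ e0)[k _ hk] := h.
by exists k; move: (hk k (leqnn k)); rewrite /= ger0_norm// exprn_ge0// invr_ge0.
Qed.

(** The graph of a continuous map is closed. *)
Lemma souslin_continuous_image (R : realType) (n : nat)
    (f : baire_space -> 'rV[R]_n) : continuous f -> souslin (range f).
Proof.
move=> fc; exists (fun z x => f z = x); last first.
  by apply/seteqP; split=> x [z]; [exists z|exists z].
move=> z x happ.
have [z' hz'] := choice happ.
(* Approximants of order k agree with z on a prefix of length k. *)
have zz : (z' : nat -> baire_space) @ \oo --> (z : baire_space).
  apply/(@pointwise_cvgP nat nat) => t.
  apply: cvg_near_cst; exists t.+1 => // k /= tk.
  by have [x' [_ h _]] := hz' k; exact: h.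
have c1 : f (z' k) @[k --> \oo] --> f z by apply: (cvg_comp _ _ zz); exact: fc.
have c2 : f (z' k) @[k --> \oo] --> x.
  apply/cvgrPdist_lt => e /half_expn_lt[k hk].
  exists k => // j /= kj; have [x' [-> _ h]] := hz' j.
  apply: le_lt_trans h (le_lt_trans _ hk).
  by rewrite ler_wiXn2l// ?invr_ge0//; lra.
exact: (cvg_unique _ c1 c2).
Qed.

Lemma souslin_set0 (R : realType) (n : nat) : souslin (set0 : set 'rV[R]_n).
Proof.
exists (fun _ _ => False); last by apply/seteqP; split=> x // [].
by move=> z x /(_ 0%N)[? [? []]].
Qed.

Lemma souslin_closed (R : realType) (n : nat) (F : set 'rV[R]_n) :
  (forall x, (forall k, exists2 y, F y & `|x - y| <= 2^-1 ^+ k) -> F x) ->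
  souslin F.
Proof.
move=> Fcl; exists (fun _ => F); last first.
  by apply/seteqP; split=> x; [exists (fun=> 0%N)|case].
move=> z x happ; apply: Fcl => k; have [z' [y [Fy _ h]]] := happ k.
by exists y.
Qed.

(** The first entry of the new sequence names the set, and the rest is the witness.
Prefixes of positive length determine the name, so closedness is inherited. *)
Lemma souslin_bigcup (R : realType) (n : nat) (A : nat -> set 'rV[R]_n) :
  (forall k, souslin (A k)) -> souslin (\bigcup_k A k).
Proof.
move=> /(_ _)/cid2-/all_sig2[C Ccl AE].
exists (fun z x => C (z 0%N) (fun i => z i.+1) x); last first.
  apply/seteqP; split=> x.
    case=> k _; rewrite AE => -[z h].
    by exists (fun i => if i is j.+1 then z j else k).
  by case=> z h; exists (z 0%N) => //; rewrite AE; exists (fun i => z i.+1).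
move=> z x happ; apply: Ccl => k.
have [z' [x' [h1 h2 h3]]] := happ k.+1.
exists (fun i => z' i.+1), x'; split.
- by rewrite -(h2 0%N).
- by move=> i ik; rewrite h2.
- apply: le_trans h3 _; rewrite ler_wiXn2l//; lra.
Qed.

(** One sequence codes countably many witnesses through a pairing of indices. A
prefix of each witness only involves finitely many entries of the code, so
closedness is inherited. *)
Lemma souslin_bigcap (R : realType) (n : nat) (A : nat -> set 'rV[R]_n) :
  (forall k, souslin (A k)) -> souslin (\bigcap_k A k).
Proof.
move=> /(_ _)/cid2-/all_sig2[C Ccl AE].
pose sl (z : nat -> nat) (k i : nat) : nat := z (pickle (k, i)).
exists (fun z x => forall k, C k (sl z k) x); last first.
  apply/seteqP; split=> x.
    move=> h; have /choice[z hz] : forall k, exists z, C k z x.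
      by move=> k; have := h k I; rewrite AE.
    exists (fun p => if unpickle p is Some (k, i) then z k i else 0%N) => k.
    suff -> : sl (fun p => if unpickle p is Some (k, i) then z k i else 0%N) k
      = z k by [].
    by apply/funext => i; rewrite /sl pickleK.
  by case=> z h k _; rewrite AE; exists (sl z k).
move=> z x happ k; apply: Ccl => m.
pose K := maxn m (\max_(i < m) (pickle (k, i : nat)).+1).
have [z' [x' [h1 h2 h3]]] := happ K.
exists (sl z' k), x'; split => //.
- move=> i im; apply: h2; rewrite leq_max; apply/orP; right.
  exact: (leq_bigmax (Ordinal im)).
- apply: le_trans h3 _; rewrite ler_wiXn2l ?leq_maxl//; lra.
Qed.

(** An open set is the countable union of the closed sets of points at distance at
least 2^-k from the complement. *)
Lemma souslin_open (R : realType) (n : nat) (U : set 'rV[R]_n) :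
  open U -> souslin U.
Proof.
move=> oU.
pose F k := [set x | forall y, `|x - y| < 2^-1 ^+ k -> U y].
have -> : U = \bigcup_k F k.
  apply/seteqP; split=> x; last first.
    by case=> k _; apply; rewrite subrr normr0 exprn_gt0//; lra.
  move=> Ux; have /nbhs_ballP[e /= e0 he] : nbhs x U by exact: open_nbhs_nbhs.
  have [k hk] := half_expn_lt e0; exists k => // y xy; apply: he.
  by rewrite -ball_normE /=; exact: lt_trans hk.
apply: souslin_bigcup => k; apply: souslin_closed => x happ y xy.
have [m hm] : exists m, 2^-1 ^+ m < 2^-1 ^+ k - `|x - y|.
  by apply: half_expn_lt; rewrite subr_gt0.
have [x' Fx' xx'] := happ m; apply: Fx'.
have -> : x' - y = (x' - x) + (x - y) by rewrite addrA subrK.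
by apply: le_lt_trans (ler_normD _ _) _; rewrite distrC; lra.
Qed.

Lemma souslin_setC_open (R : realType) (n : nat) (U : set 'rV[R]_n) :
  open U -> souslin (~` U).
Proof.
move=> oU; apply: souslin_closed => x happ Ux.
have /nbhs_ballP[e /= e0 he] : nbhs x U by exact: open_nbhs_nbhs.
have [k hk] := half_expn_lt e0; have [y /=] := happ k.
by move=> + xy; apply; apply: he; rewrite -ball_normE /=; exact: le_lt_trans hk.
Qed.

(** The sets that are Souslin together with their complement form a sigma-algebra. *)
Lemma souslin_borel (R : realType) (n : nat) (A : set 'rV[R]_n) :
  borel A -> souslin A.
Proof.
pose both (B : set 'rV[R]_n) := souslin B /\ souslin (~` B).
suff h : <<s [set U : set 'rV[R]_n | open U] >> `<=` both by move=> /h[].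
apply: smallest_sub; last first.
  by move=> U oU; split; [exact: souslin_open|exact: souslin_setC_open].
split.
- split; first exact: souslin_set0.
  by rewrite setC0; apply: souslin_open; exact: openT.
- by move=> B [h1 h2]; rewrite setTD; split; rewrite ?setCK.
- move=> B hB; split; first by apply: souslin_bigcup => k; have [] := hB k.
  by rewrite setC_bigcup; apply: souslin_bigcap => k; have [] := hB k.
Qed.

Lemma souslin_borel_or_analytic (R : realType) (n : nat) (A : set 'rV[R]_n) :
  borel A \/ analytic A -> souslin A.
Proof.
case=> [/souslin_borel//|[->|[f [fc <-]]]]; first exact: souslin_set0.
exact: souslin_continuous_image.
Qed.

(** * A greedy covering lemma *)

Lemma bernoulli_nat (p k : nat) : (p ^ k * (p + k) <= p * p.+1 ^ k)%N.
Proof.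
elim: k => [|k ih]; first by rewrite !expn0; lia.
rewrite !expnS; move: (p ^ k)%N (p.+1 ^ k)%N ih => a b ih.
have : (p.+1 * (a * (p + k)) <= p.+1 * (p * b))%N by rewrite leq_mul2l ih orbT.
nia.
Qed.

(** This is (1 - 1/q)^q <= 1/2 for q = p + 1, in a form that avoids division. *)
Lemma double_expn_pred (p : nat) : (2 * p ^ p.+1 <= p.+1 ^ p.+1)%N.
Proof.
case: p => // p; rewrite -(leq_pmul2l (m := p.+1))//.
apply: leq_trans (bernoulli_nat _ _).
by move: (p.+1 ^ _)%N => a; nia.
Qed.

(** Averaging: every x of U is covered by at least N of the at most q N elements
of Y, so some y covers at least a fraction 1/q of U. *)
Lemma greedy_step (X Y : finType) (e : X -> Y -> bool) (N q : nat)
    (U : {set X}) :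
  (forall x, (N <= #|[pred y | e x y]|)%N) -> (#|Y| <= q * N)%N -> (0 < N)%N ->
  U != finset.set0 -> exists y, (#|U| <= q * #|[set x in U | e x y]|)%N.
Proof.
move=> hN hY N0 U0; apply/existsP; apply: contraT; rewrite negb_exists.
move=> /forallP hlt.
have count : (#|U| * N <= \sum_(y : Y) #|[set x in U | e x y]|)%N.
  under eq_bigr do rewrite -sum1dep_card.
  rewrite (exchange_big_dep (mem U))/=; last by move=> y x _ /andP[].
  rewrite -sum_nat_const; apply: leq_sum => x xU.
  by rewrite sum1dep_card; apply: leq_trans (hN x) _; apply: subset_leq_card;
    apply/fintype.subsetP => y; rewrite !inE xU.
have U1 : (0 < #|U|)%N by rewrite card_gt0.
have Y1 : (0 < #|Y|)%N.
  have /set0Pn[x _] := U0.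
  by apply: leq_trans (leq_trans N0 (hN x)) (max_card _).
have : (q * \sum_(y : Y) #|[set x in U | e x y]| <= #|Y| * #|U|.-1)%N.
  rewrite big_distrr /= -sum_nat_const; apply: leq_sum => y _.
  by have := hlt y; lia.
have h1 : (q * (#|U| * N) <= q * \sum_(y : Y) #|[set x in U | e x y]|)%N.
  by rewrite leq_mul2l count orbT.
have h2 : (#|Y| * #|U|.-1 < #|Y| * #|U|)%N by rewrite ltn_pmul2l//; lia.
have h3 : (#|Y| * #|U| <= q * N * #|U|)%N by rewrite leq_mul2r hY orbT.
nia.
Qed.

(** Each greedy choice multiplies the number of uncovered points by at most 1 - 1/q,
so q choices halve it, and (L+1) q choices bring it from 2^L below 1. *)
Lemma greedy_cover (X Y : finType) (e : X -> Y -> bool) (N L q : nat) :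
  (forall x, (N <= #|[pred y | e x y]|)%N) -> (#|X| <= 2 ^ L)%N ->
  (#|Y| <= q * N)%N -> (0 < N)%N ->
  exists2 s : seq Y, (size s <= L.+1 * q)%N & forall x, exists2 y, y \in s & e x y.
Proof.
move=> hN hX hY N0.
case: (pickP (@predT X)) => [x0 _|X0]; last first.
  by exists [::] => // x; have := X0 x.
case: q hY => [|p] hY.
  have := leq_trans (hN x0) (max_card _); lia.
pose unc (s : seq Y) : {set X} := [set x | ~~ has (e x) s]%SET.
have [s [ss hs]] : exists s, (size s <= L.+1 * p.+1)%N /\
    (#|unc s| * p.+1 ^ (L.+1 * p.+1) <= #|X| * p ^ (L.+1 * p.+1))%N.
  elim: (L.+1 * p.+1)%N => [|j [s [ss hs]]].
    by exists [::]; split => //; rewrite !expn0 !muln1 max_card.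
  have [u0|u0] := eqVneq (unc s) finset.set0.
    by exists s; split; [exact: leqW|rewrite u0 cards0].
  have [y hy] := greedy_step hN hY N0 u0.
  exists (y :: s); split => //=.
  have split : (#|unc (y :: s)| + #|[set x in unc s | e x y]| = #|unc s|)%N.
    rewrite -(cardsID [set x | e x y]%SET (unc s)) addnC; congr (_ + _)%N.
      by apply: eq_card => x; rewrite !inE /= .
    by apply: eq_card => x; rewrite !inE /= negb_or.
  have h1 : (#|unc (y :: s)| * p.+1 <= #|unc s| * p)%N by nia.
  rewrite !expnS !mulnA.
  apply: (@leq_trans (#|unc s| * p * p.+1 ^ j)%N).
    by rewrite leq_mul2r h1 orbT.
  by rewrite -mulnA mulnCA (mulnC _ p) -mulnA leq_mul2l hs orbT.
exists s => // x; apply/hasP; apply: contraT => hx.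
have u0 : (0 < #|unc s|)%N.
  by rewrite card_gt0; apply/set0Pn; exists x; rewrite inE.
have h2 : (2 ^ L.+1 * p ^ (L.+1 * p.+1) <= p.+1 ^ (L.+1 * p.+1))%N.
  rewrite ![(L.+1 * _)%N]mulnC !expnM -expnMn leq_exp2r//.
  exact: double_expn_pred.
case: p => [|p] in hY ss hs h2 *.
  by move: hs; rewrite exp1n exp0n// muln0 muln1; lia.
have P0 : (0 < p.+1 ^ (L.+1 * p.+2))%N by rewrite expn_gt0.
move: hs h2; rewrite expnS; move: P0 hX.
move: (p.+1 ^ _)%N (p.+2 ^ _)%N (2 ^ L)%N => a b c a0 hX h1 h2.
have : (b <= #|unc s| * b)%N by rewrite leq_pmull.
have : (#|X| * a <= c * a)%N by rewrite leq_mul2r hX orbT.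
have : (0 < c)%N by apply: leq_trans hX; apply/card_gt0P; exists x0.
nia.
Qed.

(** * Dyadic cells, thin sets and regular points *)

Lemma rV_norm_le (R : realType) (n : nat) (x : 'rV[R]_n) (e : R) :
  0 <= e -> (forall i, `|x 0 i| <= e) -> `|x| <= e.
Proof.
move=> e0 h; rewrite /Num.norm /= mx_normrE; apply/bigmax_leP; split => //.
by move=> [i j] _ /=; rewrite ord1.
Qed.

Lemma rV_coord_le (R : realType) (n : nat) (x : 'rV[R]_n) i : `|x 0 i| <= `|x|.
Proof.
rewrite [leRHS]/Num.norm /= mx_normrE; apply/bigmax_geP; right => /=.
by exists (0, i).
Qed.

(** The index of the half-open dyadic cube of side 2^-m containing x. *)
Definition cell (R : realType) (n m : nat) (x : 'rV[R]_n) : 'rV[int]_n :=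
  \row_i Num.floor (2 ^+ m * x 0 i).

Lemma half_double (R : realType) (m : nat) : (2 : R) ^+ m * 2^-1 ^+ m = 1.
Proof. by rewrite -exprMn divff ?expr1n// pnatr_eq0. Qed.

Lemma cell_itv (R : realType) (n m : nat) (x : 'rV[R]_n) i :
  (cell m x 0 i)%:~R <= 2 ^+ m * x 0 i < (cell m x 0 i)%:~R + 1.
Proof. by rewrite mxE; have := floor_itv (2 ^+ m * x 0 i); rewrite intrD. Qed.

Lemma cell_eq_dist (R : realType) (n m : nat) (x y : 'rV[R]_n) :
  cell m x = cell m y -> `|x - y| <= 2^-1 ^+ m.
Proof.
move=> xy; apply: rV_norm_le => [|i]; first by rewrite exprn_ge0// invr_ge0.
have := cell_itv m x i; have := cell_itv m y i; rewrite xy !mxE.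
move: (_%:~R) (half_double R m) => c h /andP[a1 a2] /andP[b1 b2].
have p0 : 0 < (2^-1 : R) ^+ m by rewrite exprn_gt0// invr_gt0.
have -> : x 0 i - y 0 i =
    2^-1 ^+ m * (2 ^+ m * x 0 i - 2 ^+ m * y 0 i).
  by rewrite -mulrBr mulrA [_ * 2 ^+ m]mulrC h mul1r.
rewrite normrM gtr0_norm// ler_piMr ?(ltW p0)// ler_norml; lra.
Qed.

(** Encodes N_m(E) < 2^(tm) for all large m, where N_m(E) counts the dyadic cubes of
side 2^-m that E meets; quantifying over duplicate-free lists of cubes also rules
out unbounded sets without mentioning infinite cardinals. For t = 0 only the
empty set qualifies. *)
Definition thin (R : realType) (n : nat) (t : R) (E : set 'rV[R]_n) : Prop :=
  exists m0, forall m, (m0 <= m)%N -> forall cs : seq 'rV[int]_n, uniq cs ->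
    (forall c, c \in cs -> exists2 x, E x & cell m x = c) ->
    (size cs)%:R < 2 `^ (t * m%:R).

Definition sigma_thin (R : realType) (n : nat) (t : R) (E : set 'rV[R]_n) :=
  exists2 F : nat -> set 'rV[R]_n, forall k, thin t (F k) & E `<=` \bigcup_k F k.

Lemma thin_sigma_thin (R : realType) (n : nat) (t : R) (E : set 'rV[R]_n) :
  thin t E -> sigma_thin t E.
Proof. by move=> h; exists (fun=> E) => // x Ex; exists 0%N. Qed.

Lemma thin_set0 (R : realType) (n : nat) (t : R) : thin t (set0 : set 'rV[R]_n).
Proof.
exists 0%N => m _ [|c cs] _ h; first by rewrite powR_gt0.
by have [] := h c (mem_head _ _).
Qed.

Lemma sigma_thin_sub (R : realType) (n : nat) (t : R) (E F : set 'rV[R]_n) :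
  E `<=` F -> sigma_thin t F -> sigma_thin t E.
Proof. by move=> EF [G h1 h2]; exists G => //; exact: subset_trans h2. Qed.

Lemma sigma_thin_bigcup (R : realType) (n : nat) (t : R) (I : countType)
    (F : I -> set 'rV[R]_n) :
  (forall i, sigma_thin t (F i)) -> sigma_thin t (\bigcup_i F i).
Proof.
move=> /(_ _)/cid2-/all_sig2[G Gt FG].
exists (fun p => if unpickle p is Some (i, k) then G i k else set0).
  by move=> p; case: unpickle => [[i k]//|]; exact: thin_set0.
move=> x [i _ /FG[k _ Gx]]; exists (pickle (i, k)) => //.
by rewrite pickleK.
Qed.

Lemma sigma_thinU (R : realType) (n : nat) (t : R) (E F : set 'rV[R]_n) :
  sigma_thin t E -> sigma_thin t F -> sigma_thin t (E `|` F).
Proof.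
move=> hE hF.
have := @sigma_thin_bigcup R n t bool (fun b => if b then E else F).
move=> /(_ ltac:(by case)); apply: sigma_thin_sub => x [h|h].
  by exists true.
by exists false.
Qed.

(** The names, indexed by a countable type, of basic neighbourhoods of level k in
N^N x R^n. *)
Definition code (R : realType) (n k : nat) (u : (nat -> nat) * 'rV[R]_n) :
  seq nat * 'rV[int]_n := (mkseq u.1 k, cell k u.2).

Definition portion (R : realType) (n : nat)
    (P : (nat -> nat) * 'rV[R]_n -> Prop) (k : nat)
    (c : seq nat * 'rV[int]_n) : set 'rV[R]_n :=
  [set x | exists z, P (z, x) /\ code k (z, x) = c].

Definition regular (R : realType) (n : nat) (t : R)
    (C : (nat -> nat) -> 'rV[R]_n -> Prop) (u : (nat -> nat) * 'rV[R]_n) : Prop :=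
  C u.1 u.2 /\
  forall k, ~ sigma_thin t (portion (fun v => C v.1 v.2) k (code k u)).

(** Each irregular point lies in a basic neighbourhood with [sigma_thin] projection,
and there are only countably many basic neighbourhoods. *)
Lemma irregular_sigma_thin (R : realType) (n : nat) (t : R)
    (C : (nat -> nat) -> 'rV[R]_n -> Prop) :
  sigma_thin t [set x | exists z, C z x /\ ~ regular t C (z, x)].
Proof.
pose inC (v : (nat -> nat) * 'rV[R]_n) := C v.1 v.2.
(* Neighbourhoods whose projection is not small contribute the empty set. *)
pose F (kc : nat * (seq nat * 'rV[int]_n)) : set 'rV[R]_n :=
  [set x | sigma_thin t (portion inC kc.1 kc.2) /\ portion inC kc.1 kc.2 x].
have Fst kc : sigma_thin t (F kc).
  have [h|h] := pselect (sigma_thin t (portion inC kc.1 kc.2)).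
    by apply: sigma_thin_sub h => x [].
  apply: (@sigma_thin_sub _ _ _ _ set0) => [x []//|].
  exact/thin_sigma_thin/thin_set0.
apply: sigma_thin_sub (sigma_thin_bigcup Fst) => x [z [Cz nr]].
have [k hk] : exists k, sigma_thin t (portion inC k (code k (z, x))).
  by apply: contrapT => h; apply: nr; split => // k hk; apply: h; exists k.
by exists (k, code k (z, x)) => //; split => //; exists z.
Qed.

Lemma portion_regular_not_sigma_thin (R : realType) (n : nat) (t : R)
    (C : (nat -> nat) -> 'rV[R]_n -> Prop)
    (u : (nat -> nat) * 'rV[R]_n) (k : nat) :
  regular t C u -> ~ sigma_thin t (portion (regular t C) k (code k u)).
Proof.
move=> [_ /(_ k) nst] st; apply: nst.
apply: sigma_thin_sub (sigma_thinU st (irregular_sigma_thin t C)) => x [z [Cz cz]].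
by have [r|nr] := pselect (regular t C (z, x)); [left|right]; exists z.
Qed.

Lemma exists_regular (R : realType) (n : nat) (t : R)
    (C : (nat -> nat) -> 'rV[R]_n -> Prop) :
  ~ sigma_thin t [set x | exists z, C z x] -> exists u, regular t C u.
Proof.
move=> nst; apply: contrapT => h; apply: nst.
apply: sigma_thin_sub (irregular_sigma_thin t C) => x [z Cz]; exists z.
by split => // r; apply: h; exists (z, x).
Qed.

(** * Packing measure of thin sets *)

Lemma euclidean_dist_le (R : realType) (n : nat) (x y : 'rV[R]_n) :
  euclidean_dist x y <= n%:R * `|x - y|.
Proof.
rewrite -[leRHS]ger0_norm ?mulr_ge0// -sqrtr_sqr.
apply: ler_wsqrtr; apply: (@le_trans _ _ (\sum_(i < n) `|x - y| ^+ 2)).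
  apply: ler_sum => i _; rewrite -real_normK ?num_real// ler_sqr ?nnegrE//.
  by have := rV_coord_le (x - y) i; rewrite !mxE.
rewrite sumr_const card_ord -[leLHS]mulr_natl exprMn ler_wpM2r ?sqr_ge0//.
by rewrite -natrX ler_nat; case: n x y => // n _ _; rewrite expnS; nia.
Qed.

Lemma half_expn_powR (R : realType) (m : nat) :
  2^-1 ^+ m = 2 `^ (- m%:R) :> R.
Proof. by rewrite powRN powR_mulrn// exprVn. Qed.

(** The least m with 2^-m <= r works. *)
Lemma dyadic_level (R : realType) (r : R) : 0 < r -> r <= 1 ->
  exists m, 2^-1 ^+ m <= r <= 2 * 2^-1 ^+ m.
Proof.
move=> r0 r1; have [k hk] := half_expn_lt r0.
have ex : exists k, 2^-1 ^+ k <= r by exists k; exact: ltW.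
exists (ex_minn ex); case: ex_minnP => m -> hmin /=.
case: m hmin => [_|m hmin]; first by rewrite expr0; lra.
have : ~~ (2^-1 ^+ m <= r) by apply/negP => /hmin; rewrite ltnn.
rewrite -ltNge exprS mulrA divff ?mul1r; first exact: ltW.
by rewrite pnatr_eq0.
Qed.

(** Two balls of the same level in a packing have centres at distance greater than
2^-M, hence in different cells of side 2^-(M+n), as 2^-(M+n) n <= 2^-M. Thinness
at scale M + n then bounds their number. *)
Lemma packing_level_sum (R : realType) (n : nat) (t t' : R)
    (E : set 'rV[R]_n) (D : set nat) (c : nat -> 'rV[R]_n) (r : nat -> R)
    (X : seq nat) (lev : nat -> nat) (m0 M : nat) :
  0 <= t -> t < t' ->
  (forall m, (m0 <= m)%N -> forall cs : seq 'rV[int]_n, uniq cs ->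
    (forall c, c \in cs -> exists2 x, E x & cell m x = c) ->
    (size cs)%:R < 2 `^ (t * m%:R)) ->
  (m0 <= M)%N ->
  (forall i, D i -> E (c i)) ->
  trivIset D (fun i => euclidean_cball (c i) (r i)) ->
  uniq X -> (forall i, i \in X -> D i) ->
  (forall i, i \in X -> 2^-1 ^+ lev i <= r i <= 2 * 2^-1 ^+ lev i) ->
  \sum_(i <- X | lev i == M) (2 * r i) `^ t' <=
    2 `^ (t * n%:R + 2 * t') * (2 `^ (t - t')) ^+ M.
Proof.
move=> t0 tt' Eth mM EC triv uX XD levX.
have pos k : 0 < (2^-1 : R) ^+ k by rewrite exprn_gt0// invr_gt0.
pose Y := [seq i <- X | lev i == M].
have YP i : i \in Y -> i \in X /\ lev i = M.
  by rewrite mem_filter => /andP[/eqP].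
have uY : uniq [seq cell (M + n) (c i) | i <- Y].
  rewrite map_inj_in_uniq ?filter_uniq// => i j /YP[iX li] /YP[jX lj] ceq.
  apply: triv; [exact: XD|exact: XD|].
  have /andP[ri _] := levX i iX; have /andP[rj _] := levX j jX.
  exists (c j); rewrite /euclidean_cball /=; split; last first.
    apply: le_trans (euclidean_dist_le _ _) _.
    by rewrite subrr normr0 mulr0 (le_trans _ rj)// ltW.
  apply: le_trans (euclidean_dist_le _ _) _; apply: le_trans ri; rewrite li.
  apply: le_trans (ler_wpM2l _ (cell_eq_dist ceq)) _ => //.
  rewrite exprD mulrCA ler_piMr ?(ltW (pos _))//.
  rewrite -[X in _ <= X](half_double R n) ler_wpM2r ?(ltW (pos _))//.
  by rewrite -natrX ler_nat ltnW// ltn_expl.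
have szY : (size Y)%:R < 2 `^ (t * (M + n)%:R) :> R.
  rewrite -(size_map (fun i => cell (M + n) (c i))); apply: Eth uY _.
    exact: leq_trans (leq_addr _ _).
  by move=> _ /mapP[i /YP[iX _] ->]; exists (c i) => //; exact/EC/XD.
rewrite -big_filter -/Y.
apply: (@le_trans _ _ (\sum_(i <- Y) 2 `^ ((2 - M%:R) * t'))).
  rewrite big_seq [leRHS]big_seq; apply: ler_sum => i /YP[iX li].
  have /andP[ri ri2] := levX i iX; rewrite li in ri ri2.
  have r0 : 0 < r i by exact: lt_le_trans ri.
  rewrite powRrM; apply: ge0_ler_powR; rewrite ?nnegrE ?powR_ge0//.
    by lra.
    by rewrite mulr_ge0// ltW.
  rewrite powRB ?pnatr_eq0 ?implybT// -powRN -half_expn_powR (powR_mulrn 2)//.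
  by move: ri2; rewrite expr2; move: (_ ^+ M) => p; lra.
rewrite big_const_seq count_predT iter_addr_0 -[leLHS]mulr_natl.
apply: (@le_trans _ _ (2 `^ (t * (M + n)%:R) * 2 `^ ((2 - M%:R) * t'))).
  by rewrite ler_wpM2r ?powR_ge0// ltW.
rewrite -[(_ `^ _) ^+ M]powR_mulrn ?powR_ge0// -powRrM -!powRD ?pnatr_eq0 ?implybT//.
rewrite le_eqVlt; apply/orP; left; apply/eqP; congr (_ `^ _).
by rewrite natrD; ring.
Qed.

Lemma gap_ratio01 (R : realType) (t t' : R) : t < t' -> 0 < 2 `^ (t - t') < 1.
Proof.
move=> tt'; rewrite powR_gt0//= -opprB powRN invf_lt1 ?powR_gt0//.
rewrite [ltLHS](_ : _ = 1 `^ (t' - t)); last by rewrite powR1.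
by apply: gt0_ltr_powR; rewrite ?nnegrE ?subr_gt0// ltr1n.
Qed.

(** Summing [packing_level_sum] over the levels from J on gives a geometric series
of ratio 2^(t - t') < 1; no smaller level occurs because the radii are at most
2^-J. *)
Lemma packing_sum_le (R : realType) (n : nat) (t t' : R)
    (E : set 'rV[R]_n) (D : set nat) (c : nat -> 'rV[R]_n) (r : nat -> R)
    (X : seq nat) (m0 J : nat) :
  0 <= t -> t < t' ->
  (forall m, (m0 <= m)%N -> forall cs : seq 'rV[int]_n, uniq cs ->
    (forall c, c \in cs -> exists2 x, E x & cell m x = c) ->
    (size cs)%:R < 2 `^ (t * m%:R)) ->
  (m0 <= J)%N -> is_packing (2^-1 ^+ J) E D c r ->
  uniq X -> (forall i, i \in X -> D i) ->
  \sum_(i <- X) (2 * r i) `^ t' <=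
    2 `^ (t * n%:R + 2 * t') / (1 - 2 `^ (t - t')) * (2 `^ (t - t')) ^+ J.
Proof.
set K := 2 `^ (t * n%:R + 2 * t'); set q := 2 `^ (t - t').
move=> t0 tt' Eth mJ [EC triv] uX XD.
have /andP[q0 q1] : 0 < q < 1 by exact: gap_ratio01.
have K0 : 0 < K by rewrite powR_gt0.
have {}XD' i : i \in X -> exists m, 2^-1 ^+ m <= r i <= 2 * 2^-1 ^+ m.
  move=> /XD/EC[_ /andP[r0 r1]]; apply: dyadic_level => //.
  by apply: le_trans r1 _; rewrite exprn_ile1//; lra.
have /choice[lev levX] (i : nat) : exists m, i \in X ->
    2^-1 ^+ m <= r i <= 2 * 2^-1 ^+ m.
  have [/XD'[m hm]|] := boolP (i \in X); first by exists m.
  by exists 0%N.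
have levJ i : i \in X -> (J <= lev i)%N.
  move=> iX; have /andP[h _] := levX i iX.
  have [_ /andP[_ rJ]] := EC i (XD i iX).
  have := le_trans h rJ; rewrite ler_iXn2l//; lra.
have main M : (J <= M)%N -> \sum_(i <- X | (lev i < M)%N) (2 * r i) `^ t' +
    K / (1 - q) * q ^+ M <= K / (1 - q) * q ^+ J.
  elim: M => [|M ih]; rewrite ?leqn0 => JM.
    rewrite big_pred0 ?add0r//; first by move/eqP: JM => ->.
  move: JM; rewrite leq_eqVlt => /orP[/eqP <-|].
    rewrite big_seq_cond big_pred0 ?add0r// => i; apply/negP => /andP[/levJ].
    by rewrite leqNgt => /negP.
  rewrite ltnS => JM; apply: le_trans (ih JM).
  rewrite (bigID (fun i => lev i == M))/= addrC.
  have -> : \sum_(i <- X | (lev i < M.+1)%N && (lev i == M)) (2 * r i) `^ t' =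
      \sum_(i <- X | lev i == M) (2 * r i) `^ t'.
    by apply: eq_bigl => i; case: eqP => [->|]; rewrite ?ltnSn// andbF.
  have -> : \sum_(i <- X | (lev i < M.+1)%N && (lev i != M)) (2 * r i) `^ t' =
      \sum_(i <- X | (lev i < M)%N) (2 * r i) `^ t'.
    by apply: eq_bigl => i; lia.
  have := @packing_level_sum R n t t' E D c r X lev m0 M t0 tt' Eth (leq_trans mJ JM)
    (fun i h => (EC i h).1) triv uX XD levX.
  rewrite -/K -/q.
  have : K * q ^+ M + K / (1 - q) * q ^+ M.+1 = K / (1 - q) * q ^+ M.
    by rewrite exprS; field; rewrite subr_eq0 eq_sym; lra.
  lra.
pose M := maxn J (\max_(i <- X) (lev i).+1).
have := main M (leq_maxl _ _).
have -> : \sum_(i <- X | (lev i < M)%N) (2 * r i) `^ t' =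
    \sum_(i <- X) (2 * r i) `^ t'.
  rewrite big_seq_cond [RHS]big_seq; apply: eq_bigl => i.
  rewrite andb_idr// => iX; rewrite leq_max; apply/orP; right.
  exact: leq_bigmax_seq.
have : 0 <= K / (1 - q) * q ^+ M.
  by rewrite mulr_ge0 ?exprn_ge0 ?divr_ge0//; lra.
lra.
Qed.

Lemma packing_premeasure_ge0 (R : realType) (n : nat) (t : R)
    (E : set 'rV[R]_n) : (0 <= packing_premeasure t E)%E.
Proof.
  apply: le_ereal_inf_tmp => _ [d _ <-]; apply: ereal_sup_ubound.
  exists set0, (fun=> 0), (fun=> 0); split; last by rewrite esum_set0.
  by split => //; exact: trivIset_set0.
Qed.

Lemma thin_packing_premeasure0 (R : realType) (n : nat) (t t' : R)
    (E : set 'rV[R]_n) :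
  0 <= t -> t < t' -> thin t E -> packing_premeasure t' E = 0%E.
Proof.
move=> t0 tt' [m0 Eth].
set K := 2 `^ (t * n%:R + 2 * t'); set q := 2 `^ (t - t').
have /andP[q0 q1] : 0 < q < 1 by exact: gap_ratio01.
apply/eqP; rewrite eq_le; apply/andP; split; last first.
  exact: packing_premeasure_ge0.
apply/lee_addgt0Pr => e e0; rewrite add0e.
pose K' := K / (1 - q).
have K0 : 0 < K' by rewrite divr_gt0 ?powR_gt0//; lra.
have [J hJ] : exists J, q ^+ J < e / K'.
  have h : q ^+ x @[x --> \oo] --> (0 : R).
    by apply: cvg_expr; rewrite ger0_norm; lra.
  have /cvgr0Pnorm_lt/(_ (e / K') (divr_gt0 e0 K0))[k _ hk] := h.
  by exists k; move: (hk k (leqnn k)); rewrite /= ger0_norm// exprn_ge0// ltW.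
pose J' := maxn m0 J.
apply: (@le_trans _ _ (packing_premeasure_at t' (2^-1 ^+ J') E)).
  apply: ereal_inf_lbound; exists (2^-1 ^+ J') => //.
  by rewrite /mkset exprn_gt0// invr_gt0.
apply: ge_ereal_sup => _ [D [c [r [pk ->]]]].
apply: ge_ereal_sup => _ [X [fX XD] <-].
rewrite fsbig_finite// sumEFin lee_fin.
apply: le_trans (packing_sum_le t0 tt' Eth (leq_maxl _ _) pk
  (finmap.fset_uniq _) _) _.
  by move=> i; rewrite in_fset_set// => /set_mem/XD.
rewrite -/K' mulrC -ler_pdivlMr// (le_trans _ (ltW hJ))//.
by rewrite ler_wiXn2l ?leq_maxr ?(ltW q0) ?(ltW q1).
Qed.

Lemma sigma_thin_packing_measure0 (R : realType) (n : nat) (t t' : R)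
    (E : set 'rV[R]_n) :
  0 <= t -> t < t' -> sigma_thin t E -> packing_measure t' E = 0%E.
Proof.
move=> t0 tt' [F Fth EF].
apply/eqP; rewrite eq_le; apply/andP; split; last first.
  by apply: le_ereal_inf_tmp => _ [G _ <-]; apply: nneseries_ge0 => k _ _;
    exact: packing_premeasure_ge0.
apply: ereal_inf_lbound; exists F => //.
by apply: eseries0 => k _ _; apply: thin_packing_premeasure0 (Fth k).
Qed.

(** For s < 0 one takes t = 0, for which [sigma_thin] means empty. Otherwise t lies
strictly between s and an exponent t' < dim_P A. *)
Lemma packing_dim_not_sigma_thin (R : realType) (n : nat) (s : R)
    (A : set 'rV[R]_n) :
  A !=set0 -> (s%:E < packing_dim A)%E ->
  exists2 t, s < t & ~ sigma_thin t A.
Proof.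
move=> [a Aa] sA; have [s0|s0] := ltP s 0.
  exists 0 => // -[F Fth /(_ a Aa)[k _ Fa]].
  have [m0 /(_ m0 (leqnn _) [:: cell m0 a] isT)] := Fth k.
  rewrite mul0r powRr0 /= ltxx => h.
  suff : false by [].
  by apply: h => c; rewrite inE => /eqP ->; exists a.
have [t' st' t'A] : exists2 t', s < t' & (t'%:E < packing_dim A)%E.
  move: sA; case: packing_dim => [d|_|//].
    by rewrite lte_fin => sd; exists ((s + d) / 2); rewrite ?lte_fin; lra.
  by exists (s + 1); [lra|rewrite ltry].
exists ((s + t') / 2); first lra.
move=> th.
have h : packing_measure t' A = 0%E.
  by apply: sigma_thin_packing_measure0 th; lra.
move: t'A; rewrite ltNge => /negP; apply; apply: ereal_inf_lbound.
by exists t' => //=; split => //; lra.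
Qed.

(** * Covering the unit cube at one scale *)

(** With a = (g ln 2) / 2, the inequality 2^(gm) = exp(am)^2 >= (am)^2 beats the
linear factor. *)
Lemma linear_exp_decay (R : realType) (C g e : R) : 0 < g -> 0 < e ->
  exists m0, forall m, (m0 <= m)%N ->
    C * m.+1%:R * 2 `^ (- (g * m%:R)) <= e.
Proof.
move=> g0 e0; pose a := g * ln 2 / 2.
have l2 : 0 < ln 2 :> R by apply: ln_gt0; rewrite ltr1n.
have a0 : 0 < a by rewrite divr_gt0// mulr_gt0.
have ea0 : 0 < e * a ^+ 2 by rewrite mulr_gt0 ?exprn_gt0.
pose m0 := (Num.truncn (2 * `|C| / (e * a ^+ 2))).+1.
exists m0 => m mm0.
have mR : 2 * `|C| / (e * a ^+ 2) <= m%:R.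
  apply: le_trans (ltW (truncnS_gt _)) _; rewrite ler_nat; exact: mm0.
have m1 : 1 <= m%:R :> R by rewrite ler1n (leq_trans _ mm0).
rewrite powRN ler_pdivrMr ?powR_gt0//.
have low : (a * m%:R) ^+ 2 <= 2 `^ (g * m%:R).
  have -> : 2 `^ (g * m%:R) = expR (a * m%:R) ^+ 2.
    rewrite /powR ifF ?pnatr_eq0// -expRM_natl; congr expR.
    by rewrite /a; field.
  rewrite ler_sqr ?nnegrE ?expR_ge0 ?mulr_ge0// 1?ltW//.
  by apply: lt_le_trans (expR_ge1Dx _); lra.
apply: (@le_trans _ _ (e * (a * m%:R) ^+ 2)); last by rewrite ler_pM2l.
apply: (@le_trans _ _ (2 * `|C| * m%:R)).
  have := ler_norm C; have : 0 <= `|C| by [].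
  rewrite -[m.+1%:R]natr1; nra.
by move: mR; rewrite ler_pdivrMr//; nra.
Qed.

Lemma not_thin (R : realType) (n : nat) (t : R) (E : set 'rV[R]_n) (m0 : nat) :
  ~ thin t E -> exists m, exists cs : seq 'rV[int]_n, [/\ (m0 <= m)%N, uniq cs,
    forall c, c \in cs -> exists2 x, E x & cell m x = c &
    2 `^ (t * m%:R) <= (size cs)%:R].
Proof.
move=> nth; apply: contrapT => h; apply: nth; exists m0 => m mm0 cs ucs hcs.
rewrite ltNge; apply/negP => le; apply: h.
by exists m, cs; split.
Qed.

Lemma leq_wexp2r (a b e : nat) : (a <= b -> a ^ e <= b ^ e)%N.
Proof. by case: e => // e ab; rewrite leq_exp2r. Qed.

Lemma cell_near (R : realType) (n m : nat) (x x0 : 'rV[R]_n) i :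
  `|x - x0| <= 1 -> `|cell m x 0 i - cell m x0 0 i| <= 2 ^+ m.
Proof.
move=> xx0; have := cell_itv m x i; have := cell_itv m x0 i.
have : `|2 ^+ m * x 0 i - 2 ^+ m * x0 0 i| <= 2 ^+ m.
  rewrite -mulrBr normrM ger0_norm ?exprn_ge0// ler_piMr ?exprn_ge0//.
  by apply: le_trans xx0; have := rV_coord_le (x - x0) i; rewrite !mxE.
move: (cell m x 0 i) (cell m x0 0 i) (2 ^+ m * x 0 i) (2 ^+ m * x0 0 i).
move=> a b p q; rewrite !ler_norml => /andP[h1 h2] /andP[h3 h4] /andP[h5 h6].
have pe : (2 : R) ^+ m = ((2 : int) ^+ m)%:~R by rewrite rmorphXn.
rewrite pe in h1 h2.
have k1 : a < b + 2 ^+ m + 1 by rewrite -(ltr_int R) !rmorphD/=; lra.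
have k2 : b < a + 2 ^+ m + 1 by rewrite -(ltr_int R) !rmorphD/=; lra.
lia.
Qed.

Definition unit_cube (R : realType) (n : nat) : set 'rV[R]_n :=
  [set z | forall i, 0 <= z 0 i < 1].

(** If z, x lie in the grid cells c(z), c(x), then z - x is within 2^-m of the grid
point 2^-m (c(z) - c(x)). It thus suffices to cover the 2^(mn) or so cells of the
cube by integer translates of the cells of xs. As xs lies in a ball of radius 1,
the useful translations form a box of side O(2^m), and each target cell is
reached by exactly [size xs] of them: [greedy_cover] applies. *)
Lemma cube_translates (R : realType) (n m : nat) (x0 : 'rV[R]_n)
    (xs : seq 'rV[R]_n) :
  (0 < size xs)%N -> uniq xs -> {in xs &, injective (cell m)} ->
  (forall x, x \in xs -> `|x - x0| <= 1) ->
  exists2 ys : seq 'rV[R]_n,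
    (size xs <= 2 ^ ((m + 3) * n) /\
     size ys <= (m.+1 * n).+1 * (2 ^ ((m + 3) * n) %/ size xs).+1)%N &
    forall z, unit_cube z ->
      exists x y, [/\ x \in xs, y \in ys & `|z - x - y| <= 2^-1 ^+ m].
Proof.
move=> N0 uxs cinj near.
pose f0 := cell m x0.
pose X := {ffun 'I_n -> 'I_(2 ^ m).+1}.
pose Y := {ffun 'I_n -> 'I_(4 * 2 ^ m).+1}.
(* Cells of xs differ from f0 by at most 2^m in each coordinate and cells of the
   cube have coordinates in [0, 2^m), so subtracting f0 + 2^m makes all the
   translations c(z) - c(x) indexable by naturals up to 4 * 2^m. *)
pose shift (v : Y) i : int := (v i : nat)%:Z - f0 0 i - 2 ^+ m.
pose e (z : X) (v : Y) := has (fun x : 'rV[R]_n =>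
  [forall i, ((z i : nat)%:Z - cell m x 0 i == shift v i)]) xs.
pose g (z : X) (x : 'rV[R]_n) : Y :=
  [ffun i => inord (absz ((z i : nat)%:Z - cell m x 0 i + f0 0 i + 2 ^+ m)%R)].
have pm : (2 : int) ^+ m = (2 ^ m)%:Z by rewrite -natrX natz.
have gE z x i : x \in xs ->
    (g z x i : nat)%:Z = (z i : nat)%:Z - cell m x 0 i + f0 0 i + 2 ^+ m.
  move=> /near/(cell_near m i); rewrite -/f0 => hc.
  have zi := ltn_ord (z i).
  rewrite ffunE inordK; rewrite ?pm in hc *; lia.
have hN z : (size xs <= #|[pred v | e z v]|)%N.
  have ug : uniq [seq g z x | x <- xs].
    rewrite map_inj_in_uniq// => x y xX yX gxy; apply: cinj => //.
    apply/rowP => i; have := gE z x i xX; have := gE z y i yX.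
    by rewrite gxy; lia.
  rewrite -(size_map (g z)) -(card_uniqP ug); apply: subset_leq_card.
  apply/fintype.subsetP => _ /mapP[x xX ->]; rewrite inE; apply/hasP.
  exists x => //; apply/forallP => i; rewrite /shift gE//; lia.
have cX : (#|X| <= 2 ^ (m.+1 * n))%N.
  rewrite card_ffun !card_ord expnM leq_wexp2r//.
  by rewrite expnS; have := expn_gt0 2 m; lia.
have cY : (#|Y| <= 2 ^ ((m + 3) * n))%N.
  rewrite card_ffun !card_ord expnM leq_wexp2r//.
  by rewrite expnD; have := expn_gt0 2 m; lia.
have cYq : (#|Y| <= (2 ^ ((m + 3) * n) %/ size xs).+1 * size xs)%N.
  by apply: leq_trans cY _; rewrite ltnW// ltn_ceil.
have [vs szv hv] := greedy_cover hN cX cYq N0.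
pose pt (v : Y) : 'rV[R]_n := \row_i (2^-1 ^+ m * (shift v i)%:~R).
exists [seq pt v | v <- vs].
  split; last by rewrite size_map.
  by apply: leq_trans (leq_trans (hN [ffun=> ord0]) (max_card _)) cY.
move=> z zQ.
have zf i : 0 <= cell m z 0 i /\ cell m z 0 i < 2 ^+ m.
  have := cell_itv m z i; have /andP[z0 z1] := zQ i => /andP[h1 h2].
  have p0 : 0 < (2 : R) ^+ m by rewrite exprn_gt0.
  have k1 : 0 < cell m z 0 i + 1.
    rewrite -(ltr_int R) rmorphD /=; apply: le_lt_trans h2.
    by rewrite mulr_ge0// ltW.
  split; first by lia.
  rewrite -(ltr_int R) rmorphXn /=; apply: le_lt_trans h1 _.
  by rewrite gtr_pMr.
pose zi : X := [ffun i => inord (absz (cell m z 0 i))].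
have ziE i : (zi i : nat)%:Z = cell m z 0 i.
  have := zf i; rewrite pm => zfi; rewrite ffunE inordK; lia.
have [v vvs /hasP[x xX /forallP hx]] := hv zi.
exists x, (pt v); split => //; first exact: map_f.
apply: rV_norm_le => [|i]; first by rewrite exprn_ge0// invr_ge0.
rewrite !mxE -(eqP (hx i)) ziE.
have := cell_itv m z i; have := cell_itv m x i.
rewrite rmorphB /=; move: (cell m z 0 i)%:~R (cell m x 0 i)%:~R => a b.
move=> /andP[a1 a2] /andP[b1 b2].
have -> : z 0 i - x 0 i - 2^-1 ^+ m * (a - b) =
    2^-1 ^+ m * ((2 ^+ m * z 0 i - a) - (2 ^+ m * x 0 i - b)).
  have h := half_double R m.
  rewrite !mulrBr !mulrA [_ * 2 ^+ m]mulrC h; ring.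
rewrite normrM ger0_norm ?exprn_ge0 ?invr_ge0// ler_piMr ?exprn_ge0 ?invr_ge0//.
by rewrite ler_norml; lra.
Qed.

(** By [cube_translates] the number of translations is O(m 2^(nm) / N) with
N >= 2^(tm), so the left-hand side of the last inequality is O(m 2^(-(t-s)m)). *)
Lemma thick_cube_cover (R : realType) (n : nat) (t s w eps : R)
    (E : set 'rV[R]_n) (x0 : 'rV[R]_n) (k : nat) :
  s < t -> 0 <= w -> 0 < eps -> ~ thin t E -> (forall x, E x -> `|x - x0| <= 1) ->
  exists m (xs ys : seq 'rV[R]_n), [/\ (k <= m)%N, forall x, x \in xs -> E x,
    forall z, unit_cube z ->
      exists x y, [/\ x \in xs, y \in ys & `|z - x - y| <= 2^-1 ^+ m] &
    (size ys)%:R * (w * 2^-1 ^+ m) `^ (n%:R - s) <= eps].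
Proof.
move=> st w0 eps0 nth near.
pose C : R := n.+1%:R * 2 * 2 `^ (3 * n%:R) * w `^ (n%:R - s).
have [m0 hm0] := @linear_exp_decay R C (t - s) eps ltac:(rewrite subr_gt0//) eps0.
have [m [cs [mm0 ucs hcs szcs]]] := @not_thin R n t E (maxn m0 k) nth.
move: mm0; rewrite geq_max => /andP[{}/hm0 hm km].
have /choice[f hf] (c : 'rV[int]_n) : exists x, c \in cs -> E x /\ cell m x = c.
  have [/hcs[x Ex xc]|_] := boolP (c \in cs); first by exists x.
  by exists x0.
pose xs := [seq f c | c <- cs].
have xsP x : x \in xs -> E x /\ f (cell m x) = x.
  by move=> /mapP[c /hf[Ef fc] ->]; rewrite fc.
have uxs : uniq xs.
  rewrite map_inj_in_uniq// => c d /hf[_ hc] /hf[_ hd] fcd.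
  by rewrite -hc -hd fcd.
have N0 : (0 < size xs)%N.
  rewrite size_map -(ltr_nat R); apply: lt_le_trans szcs.
  by rewrite powR_gt0.
have [|x /xsP[/near//]|ys [szM szys] cov] := @cube_translates R n m x0 xs N0 uxs.
  by move=> x y /xsP[_ hx] /xsP[_ hy] xy; rewrite -hx xy hy.
exists m, xs, ys; split => //; first by move=> x /xsP[].
apply: le_trans hm; set d := n%:R - s.
rewrite powRM ?exprn_ge0 ?invr_ge0// half_expn_powR -powRrM.
set N := size xs in N0 szM szys.
have NR : 0 < N%:R :> R by rewrite ltr0n.
have szR : (size ys)%:R <=
    m.+1%:R * n.+1%:R * (2 * (2 `^ ((m%:R + 3) * n%:R) / N%:R)) :> R.
  apply: (@le_trans _ _ ((m.+1 * n).+1 * (2 ^ ((m + 3) * n) %/ N).+1)%:R).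
    by rewrite ler_nat.
  rewrite natrM ler_pM//.
    by rewrite -natrM ler_nat; nia.
  have -> : 2 `^ ((m%:R + 3) * n%:R) = (2 ^ ((m + 3) * n))%:R :> R.
    by rewrite natrX -powR_mulrn// natrM natrD.
  rewrite mulrA ler_pdivlMr// -!natrM ler_nat.
  have := leq_divM (2 ^ ((m + 3) * n)) N; nia.
have iN : N%:R^-1 <= 2 `^ (- (t * m%:R)) :> R.
  by rewrite powRN lef_pV2 ?posrE ?powR_gt0// /N size_map.
apply: (@le_trans _ _ (m.+1%:R * n.+1%:R * (2 * (2 `^ ((m%:R + 3) * n%:R) *
  2 `^ (- (t * m%:R)))) * (w `^ d * 2 `^ (- m%:R * d)))).
  rewrite ler_wpM2r ?mulr_ge0 ?powR_ge0//; apply: le_trans szR _.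
  by rewrite ler_wpM2l// ler_wpM2l// ler_wpM2l ?powR_ge0.
rewrite le_eqVlt; apply/orP; left; apply/eqP.
have -> : (m%:R + 3) * n%:R = 3 * n%:R + m%:R * n%:R :> R by ring.
have -> : - ((t - s) * m%:R) = m%:R * n%:R - t * m%:R - m%:R * d by rewrite /d; ring.
have pD (a b : R) : 2 `^ (a + b) = 2 `^ a * 2 `^ b.
  by rewrite powRD// pnatr_eq0 implybT.
rewrite mulNr /C !pD; ring.
Qed.

(** * Finite unions of balls and Hausdorff measure *)

(** Lists of balls given by centre and radius, for the norm of the space, i.e. the
sup norm. *)
Definition balls (R : realType) (n : nat) (bs : seq ('rV[R]_n * R)) :
  set 'rV[R]_n := [set x | exists2 b, b \in bs & `|x - b.1| <= b.2].

Lemma balls_cons (R : realType) (n : nat) (b : 'rV[R]_n * R) bs :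
  balls (b :: bs) = [set x | `|x - b.1| <= b.2] `|` balls bs.
Proof.
apply/seteqP; split=> x.
  case=> c; rewrite inE => /predU1P[->|cbs] h; [by left|by right; exists c].
case=> [h|[c cbs h]]; first by exists b; rewrite ?mem_head.
by exists c => //; rewrite inE cbs orbT.
Qed.

Lemma closed_norm_ball (R : realType) (n : nat) (c : 'rV[R]_n) (r : R) :
  closed [set x | `|x - c| <= r].
Proof.
have -> : [set x | `|x - c| <= r] = closed_ball_ Num.norm c r.
  by apply/seteqP; split=> x; rewrite /closed_ball_ /= distrC.
exact: closed_closed_ball_.
Qed.

Lemma balls_closed (R : realType) (n : nat) (bs : seq ('rV[R]_n * R)) :
  closed (balls bs).
Proof.
elim: bs => [|b bs ih]; last first.
  by rewrite balls_cons; apply: closedU => //; exact: closed_norm_ball.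
have -> : balls [::] = set0 :> set 'rV[R]_n by apply/seteqP; split=> x // [].
exact: closed0.
Qed.

Lemma balls_bounded (R : realType) (n : nat) (bs : seq ('rV[R]_n * R)) :
  exists M, forall x, balls bs x -> `|x| <= M.
Proof.
elim: bs => [|b bs [M hM]]; first by exists 0 => x [].
exists (Num.max M (`|b.1| + b.2)) => x; rewrite balls_cons => -[/= h|/hM h].
  rewrite le_max; apply/orP; right; rewrite -[x](subrK b.1).
  by apply: le_trans (ler_normD _ _) _; lra.
by rewrite le_max h.
Qed.

Lemma diam_norm_ball (R : realType) (n : nat) (c : 'rV[R]_n) (r : R) :
  (diam [set x | `|x - c| <= r]%R <= (2 * n%:R * r)%:E)%E.
Proof.
apply: ge_ereal_sup => _ [x xc [y yc <-]]; rewrite lee_fin.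
apply: le_trans (euclidean_dist_le _ _) _.
rewrite -mulrA mulrCA ler_wpM2l//.
have -> : x - y = (x - c) - (y - c) by rewrite opprB addrA subrK.
by apply: le_trans (ler_normB _ _) _; rewrite /= in xc yc; lra.
Qed.

Lemma diam_pow_ge0 (R : realType) (n : nat) (d : R) (U : set 'rV[R]_n) :
  (0 <= diam_pow d U)%E.
Proof. by rewrite /diam_pow; case: ifP => // _; exact: poweR_ge0. Qed.

Lemma diam_pow_norm_ball (R : realType) (n : nat) (d : R) (c : 'rV[R]_n) (r : R) :
  0 <= d -> 0 <= r ->
  (diam_pow d [set x | `|x - c| <= r]%R <= ((2 * n%:R * r) `^ d)%:E)%E.
Proof.
move=> d0 r0; rewrite /diam_pow; case: ifP => _.
  by rewrite lee_fin powR_ge0.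
rewrite -poweR_EFin; apply: gt0_ler_poweR => //; last exact: diam_norm_ball.
  rewrite in_itv /= leey andbT; apply: ereal_sup_ubound.
  exists c; first by rewrite /= subrr normr0.
  exists c; first by rewrite /= subrr normr0.
  by rewrite /euclidean_dist big1 ?sqrtr0// => i _; rewrite subrr expr0n.
by rewrite in_itv /= leey andbT lee_fin !mulr_ge0.
Qed.

(** No bound on the radii is required: if d > 0 and the sum of the d-th powers is at
most delta^d, then each diameter is at most delta. *)
Lemma hausdorff_measure0_balls (R : realType) (n : nat) (d : R)
    (B : set 'rV[R]_n) : 0 < d ->
  (forall e, 0 < e -> exists bs : seq ('rV[R]_n * R),
    [/\ forall b, b \in bs -> 0 <= b.2, B `<=` balls bs &
      \sum_(b <- bs) (2 * n%:R * b.2) `^ d <= e]) ->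
  hausdorff_measure d B = 0%E.
Proof.
move=> d0 cov.
have pre_ge0 delta : (0 <= hausdorff_premeasure d delta B)%E.
  apply: le_ereal_inf_tmp => _ [U _ <-]; apply: nneseries_ge0 => k _ _.
  exact: diam_pow_ge0.
apply/eqP; rewrite eq_le; apply/andP; split; last first.
  apply: le_trans (pre_ge0 1) _; apply: ereal_sup_ubound.
  by exists 1 => //; exact: ltr01.
apply: ge_ereal_sup => _ [delta /= delta0 <-].
apply/lee_addgt0Pr => e e0; rewrite add0e.
have [bs [bs0 Bbs sumbs]] : exists bs : seq ('rV[R]_n * R),
    [/\ forall b, b \in bs -> 0 <= b.2, B `<=` balls bs &
      \sum_(b <- bs) (2 * n%:R * b.2) `^ d <= Num.min e (delta `^ d)].
  by apply: cov; rewrite lt_min e0 powR_gt0.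
have small b : b \in bs -> 2 * n%:R * b.2 <= delta.
  move=> bbs; rewrite leNgt; apply/negP => lt.
  have := gt0_ltr_powR d0 _ _ lt.
  rewrite !nnegrE ltW// !mulr_ge0 ?bs0// => /(_ isT isT).
  apply/negP; rewrite -leNgt.
  have : \sum_(b <- bs) (2 * n%:R * b.2) `^ d <= delta `^ d.
    by apply: le_trans sumbs _; rewrite ge_min lexx orbT.
  apply: le_trans; rewrite (big_rem b)//= lerDl.
  by apply: sumr_ge0 => c _; exact: powR_ge0.
pose b0 : 'rV[R]_n * R := (0, 0).
pose U k : set 'rV[R]_n := if (k < size bs)%N then
  [set x | `|x - (nth b0 bs k).1| <= (nth b0 bs k).2] else set0.
apply: (@le_trans _ _ (\sum_(k <oo) diam_pow d (U k))%E).
  apply: ereal_inf_lbound; exists U => //; split.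
    move=> x /Bbs[b bbs xb]; exists (index b bs) => //.
    by rewrite /U index_mem bbs /= nth_index.
  move=> k; rewrite /U; case: ifP => kb; last first.
    by apply: ge_ereal_sup => _ [x []].
  apply: le_trans (diam_norm_ball _ _) _; rewrite lee_fin.
  by apply: small; exact: mem_nth.
rewrite (nneseries_split 0 (size bs)); last by move=> k _; exact: diam_pow_ge0.
rewrite add0n [X in (_ + X)%E]eseries0 ?adde0; last first.
  by move=> k kb _; rewrite /U ltnNge kb /= /diam_pow eqxx.
apply: (@le_trans _ _ (\sum_(0 <= k < size bs)
    ((2 * n%:R * (nth b0 bs k).2) `^ d)%:E)%E).
  rewrite big_nat [leRHS]big_nat; apply: lee_sum => k /andP[_ kb].
  by rewrite /U kb; apply: diam_pow_norm_ball; [exact: ltW|exact/bs0/mem_nth].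
rewrite sumEFin lee_fin -(big_nth b0 xpredT (fun b => (2 * n%:R * b.2) `^ d)).
by apply: le_trans sumbs _; rewrite ge_min lexx.
Qed.

(** * The tree of regular points *)

(** As the exponents increase strictly, the steps after j add up to at most
2 * 2^-(k j). *)
Lemma cauchy_halving (R : realType) (n : nat) (x : nat -> 'rV[R]_n)
    (k : nat -> nat) :
  (forall j, (k j < k j.+1)%N) ->
  (forall j, `|x j.+1 - x j| <= 2^-1 ^+ k j) ->
  exists a, forall j, `|a - x j| <= 2 * 2^-1 ^+ k j.
Proof.
move=> kinc xstep.
have p0 m : 0 < (2^-1 : R) ^+ m by rewrite exprn_gt0// invr_gt0.
have kj j : (j <= k j)%N by elim: j => // j ih; exact: leq_ltn_trans (kinc j).
have tele j i : `|x (i + j)%N - x j| + 2 * 2^-1 ^+ k (i + j)%N <= 2 * 2^-1 ^+ k j.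
  elim: i => [|i ih]; first by rewrite add0n subrr normr0 add0r.
  apply: le_trans ih; rewrite addSn; set l := (i + j)%N.
  have -> : x l.+1 - x j = (x l.+1 - x l) + (x l - x j) by rewrite addrA subrK.
  have h1 := ler_normD (x l.+1 - x l) (x l - x j).
  have h2 := xstep l.
  have h3 : 2 * 2^-1 ^+ k l.+1 <= 2^-1 ^+ k l :> R.
    apply: (@le_trans _ _ (2 * 2^-1 ^+ (k l).+1)).
      by rewrite ler_wpM2l// ler_wiXn2l ?kinc ?invr_ge0 ?invf_le1// ler1n.
    by rewrite exprS mulrA divff ?mul1r// pnatr_eq0.
  lra.
have near i j : (j <= i)%N -> `|x i - x j| <= 2 * 2^-1 ^+ k j.
  move=> ji; have := tele j (i - j)%N; rewrite subnK//.
  by have := p0 (k i); lra.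
have half_le j i : (j <= i)%N -> (2^-1 : R) ^+ i <= 2^-1 ^+ j.
  by move=> ji; rewrite ler_wiXn2l ?invr_ge0 ?invf_le1// ler1n.
have /cvg_ex[/= a xa] : cvg (x j @[j --> \oo]).
  apply/cauchy_cvgP/cauchy_exP => e e0.
  have [m hm] := half_expn_lt (divr_gt0 e0 (ltr0n R 2)).
  exists (x m); exists m => // i /= mi.
  rewrite -ball_normE /= distrC; apply: le_lt_trans (near _ _ mi) _.
  by have := half_le _ _ (kj m); lra.
exists a => j; apply/ler_addgt0Pr => e e0.
have /cvgrPdist_lt/(_ _ e0)[m _ hm] := xa.
have /= h1 := hm (maxn m j) (leq_maxl _ _).
have h2 := near _ _ (leq_maxr m j).
have -> : a - x j = (a - x (maxn m j)) + (x (maxn m j) - x j).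
  by rewrite addrA subrK.
by apply: le_trans (ler_normD _ _) _; lra.
Qed.

(** The regular points near u project onto a bounded set that is not thin, by
[portion_regular_not_sigma_thin], so [thick_cube_cover] applies and the children
are regular again. *)
Lemma regular_step (R : realType) (n : nat) (s t w eps : R)
    (C : (nat -> nat) -> 'rV[R]_n -> Prop) (u : (nat -> nat) * 'rV[R]_n)
    (k : nat) :
  s < t -> 0 <= w -> 0 < eps -> regular t C u ->
  exists m (us : seq ((nat -> nat) * 'rV[R]_n)) (ys : seq 'rV[R]_n), [/\ (k < m)%N,
    forall v, v \in us -> regular t C v /\ code k v = code k u,
    forall z, unit_cube z ->
      exists v y, [/\ v \in us, y \in ys & `|z - v.2 - y| <= 2^-1 ^+ m] &
    (size ys)%:R * (w * 2^-1 ^+ m) `^ (n%:R - s) <= eps].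
Proof.
move=> st w0 eps0 ru; pose E := portion (regular t C) k (code k u).
have nth : ~ thin t E.
  by move/thin_sigma_thin; exact: portion_regular_not_sigma_thin.
have near x : E x -> `|x - u.2| <= 1.
  move=> [z [_ [_ /cell_eq_dist h]]]; apply: le_trans h _.
  by rewrite exprn_ile1 ?invr_ge0 ?invf_le1// ler1n.
have [m [xs [ys [km xsE cov szys]]]] :=
  thick_cube_cover k.+1 st w0 eps0 nth near.
have /choice[f hf] (x : 'rV[R]_n) : exists z, E x ->
    regular t C (z, x) /\ code k (z, x) = code k u.
  have [[z hz]|h] := pselect (E x); first by exists z.
  by exists (fun=> 0%N).
exists m, [seq (f x, x) | x <- xs], ys; split => //.
  by move=> _ /mapP[x /xsE/hf h ->].
move=> z /cov[x [y [xX yY xy]]]; exists (f x, x), y; split => //.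
exact: map_f.
Qed.

(** Otherwise the sum in [regular_step] would be at least 1, because
(2^-m)^(n-s) >= 1 and at least one translation is present. *)
Lemma regular_lt_dim (R : realType) (n : nat) (s t : R)
    (C : (nat -> nat) -> 'rV[R]_n -> Prop) (u : (nat -> nat) * 'rV[R]_n) :
  s < t -> regular t C u -> s < n%:R.
Proof.
move=> st ru; rewrite ltNge; apply/negP => ns.
have half0 : 0 < 2^-1 :> R by rewrite invr_gt0.
have [m [us [ys [_ _ cov sz]]]] := regular_step 0 st ler01 half0 ru.
have [|v [y [_ yys _]]] := cov 0.
  by move=> i; rewrite mxE lexx ltr01.
have : 1 <= (1 * 2^-1 ^+ m) `^ (n%:R - s) :> R.
  rewrite mul1r -[leLHS](powRr0 (2^-1 ^+ m)).
  apply: ger_powR; last by rewrite subr_le0.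
  by rewrite exprn_gt0 ?invr_gt0//= exprn_ile1 ?invr_ge0 ?invf_le1// ler1n.
have : 1 <= (size ys)%:R :> R by rewrite ler1n; case: (ys) yys.
move: sz; nra.
Qed.

(** Every node of the tree covers the whole cube by itself; the branch followed for
a point z depends on z, but the translations of a level do not. *)
Lemma souslin_sum_unit_cube (R : realType) (n : nat) (s t : R)
    (A : set 'rV[R]_n) :
  s < t -> souslin A -> ~ sigma_thin t A ->
  exists B : set 'rV[R]_n, [/\ compact B, hausdorff_measure (n%:R - s) B = 0%E &
    @unit_cube R n `<=` minkowski_sum A B].
Proof.
move=> st [C Ccl AE]; rewrite {}AE => nst.
have [u0 ru0] := exists_regular nst.
pose d : R := n%:R - s; pose w : R := 6 * n%:R.
have p0 m : 0 < (2^-1 : R) ^+ m by rewrite exprn_gt0// invr_gt0.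
have d0 : 0 < d by rewrite subr_gt0; exact: regular_lt_dim st ru0.
pose point := ((nat -> nat) * 'rV[R]_n)%type; pose node := (point * nat)%type.
have /choice[F hF] (a : node * R) : exists r : nat * (seq point * seq 'rV[R]_n),
    regular t C a.1.1 -> 0 < a.2 ->
    [/\ (a.1.2 < r.1)%N,
      forall v, v \in r.2.1 -> regular t C v /\ code a.1.2 v = code a.1.2 a.1.1,
      forall z, unit_cube z ->
        exists v y, [/\ v \in r.2.1, y \in r.2.2 & `|z - v.2 - y| <= 2^-1 ^+ r.1] &
      (size r.2.2)%:R * (w * 2^-1 ^+ r.1) `^ (n%:R - s) <= a.2].
  have [[ru e0]|h] := pselect (regular t C a.1.1 /\ 0 < a.2); last first.
    by exists (0%N, ([::], [::])) => ru e0; case: h.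
  have w0 : 0 <= w by exact: mulr_ge0.
  have [m [us [ys h]]] := regular_step a.1.2 st w0 e0 ru.
  by exists (m, (us, ys)).
(* A level S of the tree may spend 2^-j in total, shared equally. *)
pose budget j (S : seq node) : R := 2^-1 ^+ j / (size S).+1%:R.
have budget0 j S : 0 < budget j S by rewrite divr_gt0.
pose fix stage j : seq node := if j is i.+1 then
  flatten [seq [seq (v, (F (x, budget i (stage i))).1) |
    v <- (F (x, budget i (stage i))).2.1] | x <- stage i] else [:: (u0, 0%N)].
pose Fs j x := F (x, budget j (stage j)).
have regS j : forall x, x \in stage j -> regular t C x.1.
  elim: j => [|j ih] x /=; first by rewrite inE => /eqP ->.
  move=> /flatten_mapP[y yS /mapP[v vy ->]] /=.
  by have [_ h _ _] := hF (y, _) (ih y yS) (budget0 j (stage j)); have [] := h v vy.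
have FsP j x : x \in stage j -> [/\ (x.2 < (Fs j x).1)%N,
    forall v, v \in (Fs j x).2.1 -> code x.2 v = code x.2 x.1,
    forall z, unit_cube z -> exists v y, [/\ v \in (Fs j x).2.1,
      y \in (Fs j x).2.2 & `|z - v.2 - y| <= 2^-1 ^+ (Fs j x).1] &
    (size (Fs j x).2.2)%:R * (w * 2^-1 ^+ (Fs j x).1) `^ d <= budget j (stage j)].
  move=> xS; have [h1 h2 h3 h4] := hF (x, _) (regS j x xS) (budget0 j (stage j)).
  by split => // v /h2[].
(* The radius 3 * 2^-m adds the covering error 2^-m of the step to the distance,
   at most 2 * 2^-m, from a child to the limit of a branch through it. *)
pose bs j : seq ('rV[R]_n * R) := flatten [seq [seq (y, 3 * 2^-1 ^+ (Fs j x).1)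
  | y <- (Fs j x).2.2] | x <- stage j].
pose B := \bigcap_j balls (bs j).
have sum_bs j : \sum_(b <- bs j) (2 * n%:R * b.2) `^ d <= 2^-1 ^+ j.
  rewrite big_flatten big_map big_seq.
  apply: (@le_trans _ _ (\sum_(x <- stage j | x \in stage j) budget j (stage j))).
    apply: ler_sum => x xS; rewrite big_map /= big_const_seq count_predT.
    rewrite iter_addr_0 -[leLHS]mulr_natl /=.
    have [_ _ _] := FsP j x xS; congr (_ * _ `^ _ <= _).
    by rewrite /w; ring.
  rewrite -big_seq big_const_seq count_predT iter_addr_0 -[leLHS]mulr_natl.
  by rewrite /budget mulrCA ler_piMr ?(ltW (p0 _))// ler_pdivrMr// mul1r ler_nat.
exists B; split.
- apply: bounded_closed_compact.
    have [M hM] := balls_bounded (bs 0%N).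
    exists M; split; first exact: num_real.
    by move=> K MK x /(_ 0%N I)/hM xM; apply: ltW; exact: le_lt_trans MK.
  by apply: closed_bigI => j _; exact: balls_closed.
- apply: hausdorff_measure0_balls => // e e0.
  have [j hj] := half_expn_lt e0.
  exists (bs j); split; [|by move=> x; exact|exact: le_trans (sum_bs j) (ltW hj)].
  by move=> b /flatten_mapP[x _ /mapP[y _ ->]] /=; rewrite mulr_ge0// ltW.
move=> z zQ.
have /choice[nxt hnxt] (jx : nat * node) : exists y : node, jx.2 \in stage jx.1 ->
    [/\ y \in stage jx.1.+1, y.2 = (Fs jx.1 jx.2).1,
      code jx.2.2 y.1 = code jx.2.2 jx.2.1 &
      exists2 b, b \in (Fs jx.1 jx.2).2.2 & `|z - y.1.2 - b| <= 2^-1 ^+ y.2].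
  case: jx => j x; have [xS|] := boolP (x \in stage j); last by exists x.
  have [_ hcode /(_ z zQ)[v [b [vF bF zvb]]] _] := FsP j x xS.
  exists (v, (Fs j x).1) => _; split => //=; [|exact: hcode|by exists b].
  by apply/flatten_mapP; exists x => //; apply/mapP; exists v.
pose fix br j : node := if j is i.+1 then nxt (i, br i) else (u0, 0%N).
have brS j : br j \in stage j.
  by elim: j => [|j ih]; [rewrite /= inE|have [] := hnxt (j, br j) ih].
have brP j := hnxt (j, br j) (brS j).
pose k j := (br j).2; pose x j := (br j).1.2.
have kinc j : (k j < k j.+1)%N.
  by have [_ e _ _] := brP j; rewrite /k /= e; have [] := FsP j (br j) (brS j).
have kj j : (j <= k j)%N by elim: j => // j ih; exact: leq_ltn_trans (kinc j).
have [|a ha] := cauchy_halving kinc (x := x).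
  by move=> j; have [_ _ [_ /cell_eq_dist]] := brP j.
have agree i j l : (i < k j)%N -> (br (l + j)%N).1.1 i = (br j).1.1 i.
  move=> ij; elim: l => // l <-.
  have [_ _ [/(congr1 (fun q => nth 0%N q i)) + _] _] := brP (l + j)%N.
  have il : (i < k (l + j))%N.
    apply: leq_trans ij _; elim: l => // l h.
    exact: leq_trans h (ltnW (kinc _)).
  by rewrite !nth_mkseq.
(* Entry i of the limit is settled from node i + 1 on, since that node is at
   level at least i + 1. *)
pose zeta i := (br i.+1).1.1 i.
exists a; first exists zeta.
  apply: Ccl => m; exists (br m.+1).1.1, (x m.+1); split.
  - by have [] := regS _ _ (brS m.+1).
  - move=> i im; rewrite /zeta -(agree i i.+1 (m - i)%N) ?kj//.
    by rewrite addnS subnK// ltnW.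
  - apply: le_trans (ha m.+1) _.
    apply: (@le_trans _ _ (2 * 2^-1 ^+ m.+1)).
      by rewrite ler_wpM2l// ler_wiXn2l ?kj ?invr_ge0 ?invf_le1// ler1n.
    by rewrite exprS mulrA divff ?mul1r// pnatr_eq0.
exists (z - a); last by rewrite addrC subrK.
move=> j _; have [_ e _ [b bF hb]] := brP j.
exists (b, 3 * 2^-1 ^+ (Fs j (br j)).1).
  by apply/flatten_mapP; exists (br j) => //; apply/mapP; exists b.
have h : `|a - x j.+1| <= 2 * 2^-1 ^+ (Fs j (br j)).1 by rewrite -e; exact: ha.
move: hb; rewrite e /= -/(x j.+1) => hb.
have -> : z - a - b = (z - x j.+1 - b) - (a - x j.+1).
  by apply/rowP => i; rewrite !mxE; ring.
by apply: le_trans (ler_normB _ _) _; lra.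
Qed.

Lemma unit_cube_interior (R : realType) (n : nat) :
  interior (@unit_cube R n) !=set0.
Proof.
exists (\row_i 2^-1); apply/nbhs_ballP; exists 2^-1; first by rewrite /= invr_gt0.
move=> y; rewrite -ball_normE /= => hy i.
have := le_lt_trans (rV_coord_le _ i) hy; rewrite !mxE ltr_norml.
by move=> /andP[h1 h2]; lra.
Qed.

Theorem theorem1p9 (R : realType) (n : nat) (hn : (1 <= n)%N) (s : R)
    (A : set 'rV[R]_n) (hA0 : A !=set0) (hA : borel A \/ analytic A)
    (hdim : (s%:E < packing_dim A)%E) :
  exists B : set 'rV[R]_n,
    [/\ compact B,
        hausdorff_measure (n%:R - s) B = 0%E &
        interior (minkowski_sum A B) !=set0].
Proof.
have [t st nst] := packing_dim_not_sigma_thin hA0 hdim.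
have [B [cB hB sumAB]] :=
  souslin_sum_unit_cube st (souslin_borel_or_analytic hA) nst.
exists B; split => //.
have [z hz] := @unit_cube_interior R n.
by exists z; apply: filterS hz.
Qed.
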